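(* Let $m$, $n$ and $d$ be positive integers with $m<d$, and let $b$ be a real number with $b\notin \mathbb{Z}/d$. Put $t_1=e^{-2\pi i mb}$, $t_2=e^{-2\pi i db}$, $t_1'=e^{2\pi i mb}$ and $t_2'=e^{2\pi i db}$. Then $$\sum_{j=0}^{d-1} \cos\Big(\frac{2\pi mj}{d}\Big)\cot^n\Big(\frac{\pi j}{d}+\pi b\Big) = -\sum i^{\mu+\nu+1}\,2^{\mu+\nu}\,\frac{m^\mu}{\mu!}\,\frac{d^{\nu+1}}{\nu!}\Big(t_1 A_\nu(t_2)-(-1)^{\mu+\nu}t_1' A_\nu(t_2')\Big)D(j_1,\ldots,j_n),$$ where the sum on the right is over all nonnegative integers $j_1,\ldots,j_n,\mu,\nu$ such that $2j_1+\cdots+2j_n+\mu+\nu=n-1$.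
   Context: Here $i$ is the imaginary unit and $\mathbb{Z}/d=\{k/d : k\in\mathbb{Z}\}$. For a complex number $t\neq 1$, the numbers $A_\nu(t)$, $\nu\ge 0$, are defined by the power series expansion about $z=0$: $\frac{1}{te^z-1}=\sum_{\nu=0}^{\infty}\frac{A_\nu(t)}{\nu!}z^\nu$ (e.g. $A_0(t)=\frac{1}{t-1}$, $A_1(t)=\frac{-t}{(t-1)^2}$). For $j\ge 0$, $C_j=\frac{(-1)^j2^{2j}B_{2j}}{(2j)!}$, where $B_k$ are the Bernoulli numbers ($\frac{x}{e^x-1}=\sum_{k\ge 0}B_k\frac{x^k}{k!}$); thus $C_0=1$, $C_1=-\frac13$, $C_2=-\frac1{45}$, and these are the coefficients in $\cot(\pi w)=\sum_{j\ge 0}C_j\pi^{2j-1}w^{2j-1}$ near $w=0$. Finally $D(j_1,\ldots,j_n)=\prod_{r=1}^{n}C_{j_r}$. *)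

(* Defs.v *)
From mathcomp Require Export all_boot all_order all_algebra.
From mathcomp Require Export complex.
From mathcomp Require Export boolp classical_sets reals topology normedtype.
From mathcomp Require Export sequences exp trigo.
Export Order.TTheory GRing.Theory Num.Theory.
Export numFieldNormedType.Exports.

Set Implicit Arguments.
Unset Strict Implicit.
Unset Printing Implicit Defensive.

Local Open Scope classical_set_scope.
Local Open Scope complex_scope.
Local Open Scope ring_scope.

Definition cexp (R : realType) (z : R[i]) : R[i] :=
  (expR (complex.Re z))%:C * (cos (complex.Im z) +i* sin (complex.Im z)).

Definition cot (R : realType) (x : R) : R := cos x / sin x.

(* A punctured neighbourhood of 0 still determines the coefficients uniquely,
   and it accommodates z / (e^z - 1), whose value at 0 is 0 / 0 = 0 here
   instead of its limit 1.  The norm topology is attached to R[i]^o, not to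
   R[i] itself. *)
Definition power_series_at0 (R : realType) (f : R[i] -> R[i])
    (a : nat -> R[i]) : Prop :=
  \forall z \near (0 : R[i]^o)^', [series (a k * z ^+ k : R[i]^o)]_k @ \oo --> (f z : R[i]^o).

(* The expansion coefficients of f about 0; the zero sequence if f has no such
   expansion. *)
Definition coefs_at0 (R : realType) (f : R[i] -> R[i]) : nat -> R[i] :=
  xget (fun=> 0) [set a | power_series_at0 f a].

Definition A (R : realType) (nu : nat) (t : R[i]) : R[i] :=
  nu`!%:R * coefs_at0 (fun z => (t * cexp z - 1)^-1) nu.

Definition bernoulli_num (R : realType) (k : nat) : R[i] :=
  k`!%:R * coefs_at0 (fun x : R[i] => x / (cexp x - 1)) k.

Definition Ccoef (R : realType) (j : nat) : R[i] :=
  (-1) ^+ j * 2 ^+ j.*2 * bernoulli_num R j.*2 / (j.*2)`!%:R.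

Definition Dcoef (R : realType) (n : nat) (j : 'I_n -> nat) : R[i] :=
  \prod_(r < n) Ccoef R (j r).

(* Main.v *)
Require Import Defs.
From HB Require Import structures.
From mathcomp Require Import ring zify lra.

(** Why the identity holds.  Put [w = e^(2 pi i / d)], [z = e^(2 pi i b)] and
    [x_j = z w^j], so that the [x_j] are the roots of [x^d = z^d] and
    [cot (pi j / d + pi b) = i h(x_j)] with [h(x) = (x + 1) / (x - 1)].  Writing the
    cosine as half the sum of [w^(m j)] and [w^(- m j)] turns the left-hand side into
    two sums [\sum_j w^(m j) h(x_j)^n], the second one for [w^-1] and [z^-1] because
    [h(1/x) = - h(x)].  Analytically, the rational function
    [x^(m-1) h(x)^n d / (z^-d x^d - 1)] has residue [x_j^m h(x_j)^n] at [x_j], and these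
    add up to [z^m] times the first sum.  As [0 < m < d], there is no residue at [0]
    or at infinity, so the residue at [x = 1] gives the answer; the substitution
    [x = e^u] expresses that residue by the expansions that define [C_j] and [A_nu].

    The residue calculus is carried out with formal power series in [X] (standing for
    [u]), one pole at a time.  Let [E = exp X] and [H = X (E + 1) / (E - 1)], which is
    [X coth (X/2)].
    - The residue of [h^n / (x - a)] at [x = 1] is [1 - h(a)^n] ([fcoth_pole]).
      Since [H - X h(a)] is a multiple of [E - a], this follows by induction on [n]
      from the residues of [coth^k] alone ([fcoth_res]), and these come from the
      fact that the derivative of a Laurent series has residue zero ([fcoth_rec]).
    - The partial fractions of [d x^(m-1) / (z^-d x^d - 1)] at the [x_j]
      ([sum_root_pole]) reduce the sum to those residues; the constants [1] cancel
      because [\sum_j x_j^m = 0] ([sum_root_coth]).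

    The coefficients of a holomorphic function are recognised by uniqueness of
    power series ([coefs_at0E]).  The formal inverse of a series with bounded
    coefficients has geometrically bounded coefficients, so it expands the
    reciprocal function ([power_series_inv]); hence [A_nu] and [B_k] are coefficients
    of formal inverses ([A_fps], [bernoulli_fps]) and [C_j] is, up to a constant
    factor, one of [H] ([Ccoef_fps]).  Expanding the coefficient of the product over
    all index tuples ([fcoef_prod_expand]) gives the right-hand side. *)

Set Implicit Arguments.
Unset Strict Implicit.
Unset Printing Implicit Defensive.

Local Open Scope complex_scope.
Local Open Scope ring_scope.

(** * Formal power series *)

(** A record instead of the bare type [nat -> K], on which multiplication would
    mean the pointwise product. *)
Record fps (K : Type) := Fps { fcoef :> nat -> K }.

Lemma fpsP (K : Type) (f g : fps K) : (forall k, f k = g k) -> f = g.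
Proof. by case: f g => f [g] /= fg; congr Fps; apply/funext. Qed.

HB.instance Definition _ (K : Type) := gen_eqMixin (fps K).
HB.instance Definition _ (K : Type) := gen_choiceMixin (fps K).

Section FpsRing.
Variable K : comNzRingType.
Implicit Types f g h : fps K.

Definition fps0 : fps K := Fps (fun=> 0).
Definition fps1 : fps K := Fps (fun k => (k == 0)%:R).
Definition fps_opp f : fps K := Fps (fun k => - f k).
Definition fps_add f g : fps K := Fps (fun k => f k + g k).
Definition fps_mul f g : fps K :=
  Fps (fun k => \sum_(i < k.+1) f i * g (k - i)%N).

Fact fps_addA : associative fps_add.
Proof. by move=> f g h; apply: fpsP => k /=; rewrite addrA. Qed.

Fact fps_addC : commutative fps_add.
Proof. by move=> f g; apply: fpsP => k /=; rewrite addrC. Qed.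

Fact fps_add0 : left_id fps0 fps_add.
Proof. by move=> f; apply: fpsP => k /=; rewrite add0r. Qed.

Fact fps_addN : left_inverse fps0 fps_opp fps_add.
Proof. by move=> f; apply: fpsP => k /=; rewrite addNr. Qed.

HB.instance Definition _ :=
  GRing.isZmodule.Build (fps K) fps_addA fps_addC fps_add0 fps_addN.

(** Truncations are the bridge to polynomials, whose ring axioms yield those of the
    Cauchy product. *)
Definition trunc (N : nat) f : {poly K} := \poly_(i < N.+1) f i.

Lemma coef_trunc N f k : (k <= N)%N -> (trunc N f)`_k = f k.
Proof. by move=> kN; rewrite coef_poly ltnS kN. Qed.

Lemma fps_mul_trunc N f g (p q : {poly K}) k : (k <= N)%N ->
  (forall i, (i <= N)%N -> p`_i = f i) -> (forall i, (i <= N)%N -> q`_i = g i) ->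
  (p * q)`_k = fps_mul f g k.
Proof.
move=> kN pf qg; rewrite coefM; apply: eq_bigr => i _.
by rewrite pf ?qg // (leq_trans _ kN) ?leq_subr // -ltnS.
Qed.

Lemma trunc_mul N f g k : (k <= N)%N -> (trunc N f * trunc N g)`_k = fps_mul f g k.
Proof. by move=> kN; apply: (fps_mul_trunc kN) => i; exact: coef_trunc. Qed.

Fact fps_mulC : commutative fps_mul.
Proof.
move=> f g; apply: fpsP => k; have fg := trunc_mul _ _ (leqnn k).
exact: etrans (esym (fg f g)) (etrans (congr1 (fun p : {poly K} => p`_k) (mulrC _ _)) (fg g f)).
Qed.

Fact fps_mulA : associative fps_mul.
Proof.
move=> f g h; apply: fpsP => k; have tr f' := @coef_trunc k f'.
have fgh : (trunc k f * (trunc k g * trunc k h))`_k = fps_mul f (fps_mul g h) k.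
  by apply: (fps_mul_trunc (leqnn k)) => i ik; [exact: tr | exact: trunc_mul].
rewrite mulrA in fgh; apply: etrans (esym fgh) _.
by apply: (fps_mul_trunc (leqnn k)) => i ik; [exact: trunc_mul | exact: tr].
Qed.

Fact fps_mul1 : left_id fps1 fps_mul.
Proof.
move=> f; apply: fpsP => k /=; rewrite big_ord_recl mul1r subn0 big1 ?addr0 // => i _.
by rewrite mul0r.
Qed.

Fact fps_mulD : left_distributive fps_mul fps_add.
Proof.
move=> f g h; apply: fpsP => k /=; rewrite -big_split /=.
by apply: eq_bigr => i _; rewrite mulrDl.
Qed.

Fact fps1_neq0 : fps1 != fps0.
Proof. by apply/eqP => /(congr1 (fun f : fps K => f 0)) /= /eqP; rewrite oner_eq0. Qed.

HB.instance Definition _ := GRing.Zmodule_isComNzRing.Build (fps K)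
  fps_mulA fps_mulC fps_mul1 fps_mulD fps1_neq0.

Lemma fcoef1 k : (1 : fps K) k = (k == 0)%:R. Proof. by []. Qed.

Lemma fcoefD f g k : (f + g) k = f k + g k. Proof. by []. Qed.

Lemma fcoefB f g k : (f - g) k = f k - g k. Proof. by []. Qed.

Lemma fcoefM f g k : (f * g) k = \sum_(i < k.+1) f i * g (k - i)%N.
Proof. by []. Qed.

Lemma fcoef_sum (I : Type) (r : seq I) (P : pred I) (F : I -> fps K) k :
  (\sum_(i <- r | P i) F i) k = \sum_(i <- r | P i) F i k.
Proof. by elim/big_rec2: _ => // i x y _ <-. Qed.

Definition fconst (c : K) : fps K := Fps (fun k => if k is 0 then c else 0).
Definition fX : fps K := Fps (fun k => (k == 1)%:R).

Lemma fcoefCM c f k : (fconst c * f) k = c * f k.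
Proof. by rewrite fcoefM big_ord_recl subn0 big1 ?addr0 // => i _; rewrite mul0r. Qed.

Lemma fcoefXM f k : (fX * f) k.+1 = f k.
Proof.
rewrite fcoefM big_ord_recl mul0r add0r big_ord_recl mul1r big1 ?addr0 => [|i _].
  by rewrite subSS subn0.
by rewrite mul0r.
Qed.

Lemma fcoefXM0 f : (fX * f) 0 = 0.
Proof. by rewrite fcoefM big_ord1 mul0r. Qed.

Lemma fX_inj : injective ( *%R fX).
Proof. by move=> f g fg; apply: fpsP => k; rewrite -(fcoefXM f) -(fcoefXM g) fg. Qed.

Fact fconst_is_zmod : zmod_morphism fconst.
Proof. by move=> a b; apply: fpsP => -[|k] //; rewrite fcoefB /= subr0. Qed.

Fact fconst_is_monoid : monoid_morphism fconst.
Proof.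
split; first by apply: fpsP; case.
by move=> a b; apply: fpsP => k; rewrite fcoefCM; case: k => //= k; rewrite mulr0.
Qed.

HB.instance Definition _ :=
  GRing.isZmodMorphism.Build K (fps K) fconst fconst_is_zmod.
HB.instance Definition _ :=
  GRing.isMonoidMorphism.Build K (fps K) fconst fconst_is_monoid.

(** The substitution of [c X] for [X]. *)
Definition fscale (c : K) f : fps K := Fps (fun k => c ^+ k * f k).

Fact fscale_is_zmod c : zmod_morphism (fscale c).
Proof. by move=> f g; apply: fpsP => k; rewrite /= mulrBr. Qed.

Fact fscale_is_monoid c : monoid_morphism (fscale c).
Proof.
split; first by apply: fpsP => -[|k]; rewrite /= ?mulr0 // mul1r.
move=> f g; apply: fpsP => k; rewrite fcoefM /= big_distrr /=; apply: eq_bigr => i _.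
by rewrite mulrACA -exprD subnKC // -ltnS.
Qed.

HB.instance Definition _ c :=
  GRing.isZmodMorphism.Build (fps K) (fps K) (fscale c) (fscale_is_zmod c).
HB.instance Definition _ c :=
  GRing.isMonoidMorphism.Build (fps K) (fps K) (fscale c) (fscale_is_monoid c).

Lemma fscaleX c : fscale c fX = fconst c * fX.
Proof.
by apply: fpsP => -[|[|k]]; rewrite fcoefCM /= ?mulr0 // expr1.
Qed.

Lemma fscaleC c a : fscale c (fconst a) = fconst a.
Proof. by apply: fpsP => -[|k] /=; rewrite ?mul1r ?mulr0. Qed.

(** The derivation [X d/dX]: unlike [d/dX] it does not shift degrees, so it stays
    inside power series when a Laurent series is multiplied by a power of [X]. *)
Definition ftheta f : fps K := Fps (fun k => f k *+ k).

Lemma fcoef_theta f k : ftheta f k = f k *+ k. Proof. by []. Qed.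

Lemma fthetaD f g : ftheta (f + g) = ftheta f + ftheta g.
Proof. by apply: fpsP => k /=; rewrite mulrnDl. Qed.

Lemma fthetaM f g : ftheta (f * g) = ftheta f * g + f * ftheta g.
Proof.
apply: fpsP => k; rewrite fcoef_theta fcoefD !fcoefM -big_split /= -sumrMnl.
apply: eq_bigr => i _ /=; rewrite mulrnAl mulrnAr -mulrnDr subnKC //.
by rewrite -ltnS.
Qed.

Lemma ftheta1 : ftheta 1 = 0.
Proof. by apply: fpsP => -[|k] //=; rewrite mul0rn. Qed.

Lemma fthetaX : ftheta fX = fX.
Proof. by apply: fpsP => -[|[|k]] //=; rewrite mul0rn. Qed.

Lemma ftheta_exp f n : ftheta (f ^+ n.+1) = (f ^+ n * ftheta f) *+ n.+1.
Proof.
elim: n => [|n IH]; first by rewrite mul1r.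
by rewrite exprS fthetaM IH mulrnAr mulrA -exprS mulrC -mulrS.
Qed.

Lemma fcoefM0 f g : (f * g) 0 = f 0 * g 0.
Proof. by rewrite fcoefM big_ord1. Qed.

Lemma fcoef_exp_small f n k : f 0 = 0 -> (k < n)%N -> (f ^+ n) k = 0.
Proof.
move=> f0; elim: n k => // n IH k kn; rewrite exprS fcoefM big_ord_recl f0 mul0r add0r.
rewrite big1 // => i _; rewrite [X in _ * X]IH ?mulr0 //=.
by have := ltn_ord i; rewrite /bump /=; lia.
Qed.
End FpsRing.
Arguments fX {K}.

Section FpsInv.
Variable K : fieldType.
Implicit Types f g : fps K.

(** With [h = 1 - f / f(0)] of zero constant term, [1 / f] is the geometric series in
    [h] divided by [f(0)]; only the powers up to [k] contribute to the coefficient [k]. *)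
Definition fps_inv f : fps K :=
  let h := 1 - fconst (f 0)^-1 * f in
  Fps (fun k => (f 0)^-1 * (\sum_(l < k.+1) h ^+ l) k).

Lemma mul_fps_inv f : f 0 != 0 -> f * fps_inv f = 1.
Proof.
move=> f0; pose u := fconst (f 0)^-1 * f; pose h := 1 - u.
have h0 : h 0 = 0 by rewrite fcoefB fcoef1 fcoefCM mulVf // subrr.
have inv_trunc j k : (j <= k)%N ->
    fps_inv f j = (fconst (f 0)^-1 * \sum_(l < k.+1) h ^+ l) j.
  move=> jk; rewrite fcoefCM /=; congr (_ * _).
  have -> : \sum_(l < k.+1) h ^+ l = \sum_(l < j.+1) h ^+ l + \sum_(j.+1 <= l < k.+1) h ^+ l.
    by rewrite -!(big_mkord xpredT (fun l => h ^+ l)) -big_cat_nat.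
  rewrite fcoefD (_ : (\sum_(j.+1 <= l < k.+1) h ^+ l) j = 0) ?addr0 //.
  rewrite fcoef_sum big_nat_cond big1 // => l /andP[/andP[jl _] _].
  exact: fcoef_exp_small.
apply: fpsP => k; rewrite fcoefM.
under eq_bigr => i _ do rewrite (inv_trunc _ k) ?leq_subr //.
rewrite -fcoefM mulrA [f * _]mulrC -/u (_ : u = 1 - h); last by rewrite opprB addrC subrK.
rewrite -opprB mulNr -subrX1 opprB fcoefB fcoef_exp_small //.
by rewrite subr0.
Qed.

End FpsInv.

(** * The series of X coth (X/2) and its residues *)

Section Algebra.
Variable K : numFieldType.
Implicit Types f g : fps K.

(** The series of [e^(a X)]. *)
Definition fexp (a : K) : fps K := Fps (fun k => a ^+ k / k`!%:R).

Lemma factr_neq0 k : k`!%:R != 0 :> K.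
Proof. by rewrite pnatr_eq0 -lt0n fact_gt0. Qed.

Lemma fexp0 : fexp 0 = 1.
Proof.
by apply: fpsP => -[|k]; rewrite /= expr0n /= ?mul0r // fact0 divr1.
Qed.

Lemma fexpD a b : fexp (a + b) = fexp a * fexp b.
Proof.
apply: fpsP => k; rewrite fcoefM /= addrC exprDn mulr_suml; apply: eq_bigr => i _.
have ik : (i <= k)%N by rewrite -ltnS.
have := factr_neq0; rewrite -(bin_fact ik) !natrM => nz.
have b0 : 'C(k, i)%:R != 0 :> K by rewrite pnatr_eq0 -lt0n bin_gt0.
by rewrite -mulr_natr; field; rewrite b0 !nz.
Qed.

Lemma fexpMn a k : fexp (a *+ k) = fexp a ^+ k.
Proof.
by elim: k => [|k IH]; rewrite ?mulr0n ?fexp0 // mulrS fexpD IH exprS.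
Qed.

Lemma fscale_fexp c a : fscale c (fexp a) = fexp (c * a).
Proof. by apply: fpsP => k; rewrite /= exprMn mulrA. Qed.

Lemma ftheta_fexp1 : ftheta (fexp 1) = fX * fexp 1.
Proof.
apply: fpsP => -[|k]; first by rewrite fcoefXM0.
rewrite fcoefXM fcoef_theta -mulr_natl.
have -> : fexp 1 k.+1 = k.+1%:R^-1 * fexp 1 k.
  by rewrite /= !expr1n !div1r factS natrM invfM.
by rewrite mulVKf // pnatr_eq0.
Qed.

Local Notation E := (fexp 1).

(** The series of [(e^X - 1) / X]. *)
Definition fexp1m_divX : fps K := Fps (fun k => (k.+1)`!%:R^-1).

Lemma fexp1m_divXE : fX * fexp1m_divX = E - 1.
Proof.
apply: fpsP => -[|k]; first by rewrite fcoefXM0 fcoefB /= expr0 fact0 divr1 subrr.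
by rewrite fcoefXM fcoefB fcoef1 subr0 /= expr1n div1r.
Qed.

(** The series of [X / (e^X - 1)], with coefficients [B_k / k!]. *)
Definition fbern : fps K := fps_inv fexp1m_divX.

Lemma fbernE : fexp1m_divX * fbern = 1.
Proof. by rewrite mul_fps_inv //= invr1 oner_eq0. Qed.

Lemma fbern_mul : (E - 1) * fbern = fX.
Proof. by rewrite -fexp1m_divXE -mulrA fbernE mulr1. Qed.

Lemma mul_fbern : E * fbern = fX + fbern.
Proof. by rewrite -fbern_mul; ring. Qed.

(** The series of [X coth (X/2) = X (e^X + 1) / (e^X - 1)], twice the even part of
    [X / (e^X - 1)]. *)
Definition fcoth : fps K := 2 * fbern + fX.

(** The only odd term of [X / (e^X - 1)] is [- X / 2], which [fcoth] removes. *)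
Lemma fbern_reflect : fscale (-1) fbern = fbern + fX.
Proof.
apply: fX_inj; set b' := fscale _ _.
have b'E : (1 - E) * b' = - (fX * E).
  have e1 : E * fexp (-1) = 1 by rewrite -fexpD subrr fexp0.
  have := congr1 (fscale (-1)) fbern_mul.
  rewrite rmorphM rmorphB rmorph1 /= fscale_fexp mulr1 fscaleX rmorphN1 mulN1r -/b' => h.
  rewrite -[1 - E]mul1r -{1}e1.
  have -> : E * fexp (-1) * (1 - E) * b' = E * ((1 - E) * fexp (-1) * b') by ring.
  by rewrite mulrBl mul1r e1 h; ring.
have -> : fX * b' = - (fbern * ((1 - E) * b')) by rewrite -fbern_mul; ring.
by rewrite b'E addrC -mul_fbern; ring.
Qed.

Lemma fcoth_even : fscale (-1) fcoth = fcoth.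
Proof.
rewrite rmorphD rmorphM rmorph_nat /= fbern_reflect fscaleX rmorphN1 /fcoth; ring.
Qed.

Lemma fcoth_odd k : odd k -> fcoth k = 0.
Proof.
move=> ok; have := congr1 (fun f : fps K => f k) fcoth_even.
rewrite /= -signr_odd ok expr1 mulN1r => /eqP.
by rewrite eqNr => /eqP.
Qed.

(** Apply [X d/dX] to [(e^X - 1) fbern = X] and divide by [e^X - 1]. *)
Lemma ftheta_fbern : ftheta fbern = fbern - fX * fbern - fbern ^+ 2.
Proof.
have th : fX * E * fbern + (E - 1) * ftheta fbern = fX.
  have := congr1 (@ftheta K) fbern_mul; rewrite fthetaM fthetaX.
  have -> : ftheta (E - 1) = fX * E => //.
  apply/eqP; rewrite -subr_eq0; apply/eqP.
  have : ftheta ((E - 1) + 1) = fX * E by rewrite subrK ftheta_fexp1.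
  by rewrite fthetaD ftheta1 addr0 => ->; rewrite subrr.
apply: fX_inj.
have -> : fX * ftheta fbern = fbern * ((E - 1) * ftheta fbern).
  by rewrite -{1}fbern_mul; ring.
have -> : (E - 1) * ftheta fbern = fX - fX * (E * fbern).
  by rewrite -{1}th; ring.
rewrite mul_fbern; ring.
Qed.

(** The Riccati equation [2 y' = 1 - y^2] of [y = coth (X/2)], cleared of denominators
    through [fcoth = X y]. *)
Lemma ftheta_fcoth : 2 * (ftheta fcoth - fcoth) = fX ^+ 2 - fcoth ^+ 2.
Proof.
have -> : ftheta fcoth = 2 * ftheta fbern + fX.
  by rewrite /fcoth fthetaD fthetaX !(mulr_natl _ 2) !mulr2n fthetaD.
rewrite ftheta_fbern /fcoth; ring.
Qed.

(** In terms of [y = coth (X/2)], both sides are residues, of [y^(k+2)] and of [y^k].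
    They agree because [y^k (1 - y^2) = 2 y^k y'] is a derivative.  The factor [fX]
    lets the case [k = 0], the residue of a constant, be stated as well. *)
Lemma fcoth_rec k : (fX * fcoth ^+ k.+2) k.+2 = (fX * fcoth ^+ k) k.
Proof.
have := congr1 (fun f => (f * fcoth ^+ k) k.+1) ftheta_fcoth.
have -> : 2 * (ftheta fcoth - fcoth) * fcoth ^+ k =
  2 * ((fcoth ^+ k * ftheta fcoth) - fcoth ^+ k.+1) by rewrite exprSr; ring.
have -> : (fX ^+ 2 - fcoth ^+ 2) * fcoth ^+ k = fX * (fX * fcoth ^+ k) - fcoth ^+ k.+2.
  by rewrite !exprSr; ring.
rewrite fcoefB !fcoefXM.
have -> : 2 * (fcoth ^+ k * ftheta fcoth - fcoth ^+ k.+1) =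
   fconst 2 * (fcoth ^+ k * ftheta fcoth - fcoth ^+ k.+1) by rewrite rmorph_nat.
rewrite fcoefCM fcoefB.
have -> : (fcoth ^+ k * ftheta fcoth) k.+1 = (fcoth ^+ k.+1) k.+1.
  have : (ftheta (fcoth ^+ k.+1)) k.+1 = (fcoth ^+ k.+1) k.+1 *+ k.+1 by [].
  rewrite ftheta_exp.
  have -> : (fcoth ^+ k * ftheta fcoth) *+ k.+1 = fconst k.+1%:R * (fcoth ^+ k * ftheta fcoth).
    by rewrite rmorph_nat mulr_natl.
  rewrite fcoefCM -[RHS]mulr_natl => /mulfI; apply.
  by rewrite pnatr_eq0.
by rewrite subrr mulr0 => /esym/eqP; rewrite subr_eq0 => /eqP.
Qed.

Lemma fcoth_res k : (fX * fcoth ^+ k) k + (fX * fcoth ^+ k.+1) k.+1 = 2.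
Proof.
elim: k => [|k IH]; last by rewrite fcoth_rec addrC.
have b0 : fbern 0 = 1.
  have := congr1 (fun f => f 0) fbernE; rewrite fcoefM0 fcoef1.
  have -> : fexp1m_divX 0 = 1 by rewrite /= invr1.
  by rewrite mul1r.
have fcoth0 : fcoth 0 = 2.
  rewrite /fcoth fcoefD.
  have -> : 2 * fbern = fconst 2 * fbern by rewrite rmorph_nat.
  by rewrite fcoefCM b0 mulr1 addr0.
by rewrite fcoefXM0 add0r fcoefXM expr1.
Qed.

(** The difference [h(x) - h(a)] equals [- 2 (x - a) / ((x - 1) (a - 1))]; this is that
    identity at [x = e^X], multiplied by [X]. *)
Lemma fcoth_step (a : K) : a != 1 ->
  fcoth = fX * fconst ((a + 1) / (a - 1)) - fconst (2 / (a - 1)) * (E - fconst a) * fbern.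
Proof.
move=> a1; have a1' : a - 1 != 0 by rewrite subr_eq0.
have -> : (E - fconst a) = (E - 1) - fconst (a - 1).
  by rewrite rmorphB rmorph1; ring.
rewrite mulrBr mulrBl -[_ * (E - 1) * _]mulrA fbern_mul.
have -> : fX * fconst ((a + 1) / (a - 1)) = fX + fconst (2 / (a - 1)) * fX.
  have -> : (a + 1) / (a - 1) = 1 + 2 / (a - 1) by field.
  by rewrite rmorphD rmorph1; ring.
rewrite -rmorphM divfK // rmorph_nat /fcoth; ring.
Qed.

(** The residue at [X = 0] of [coth (X/2)^n e^X / (e^X - a)], the value at infinity
    minus the value at [a] of [((x + 1) / (x - 1))^n].  Each step of the induction
    trades one factor of [coth] for its value at [a], up to a term free of the pole
    at [a], by [fcoth_step]. *)
Lemma fcoth_pole (a : K) (G : fps K) n : a != 1 -> G * (E - fconst a) = 1 ->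
  (fX * fcoth ^+ n * E * G) n = 1 - ((a + 1) / (a - 1)) ^+ n.
Proof.
move=> a1 Ga; have a1' : a - 1 != 0 by rewrite subr_eq0.
elim: n => [|n IH]; first by rewrite -!mulrA fcoefXM0 expr0 subrr.
have -> : fX * fcoth ^+ n.+1 * E * G =
  fconst ((a + 1) / (a - 1)) * (fX * (fX * fcoth ^+ n * E * G))
   - fconst (a - 1)^-1 * (fX * (fX * fcoth ^+ n) + fX * fcoth ^+ n.+1).
  rewrite exprS {1}(fcoth_step a1).
  set h := fconst (_ / _).
  have -> : fX * ((fX * h - fconst (2 / (a - 1)) * (E - fconst a) * fbern) * fcoth ^+ n) * E * G
    = h * (fX * (fX * fcoth ^+ n * E * G))
     - fX * fconst (2 / (a - 1)) * (G * (E - fconst a)) * (E * fbern) * fcoth ^+ n by ring.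
  rewrite Ga mul_fbern mulrC [_ / _]mulrC rmorphM rmorph_nat /fcoth; ring.
rewrite fcoefB !fcoefCM fcoefD !fcoefXM IH -(fcoefXM (fcoth ^+ n.+1)) fcoth_res exprS.
by field.
Qed.

End Algebra.

(** * Summation over the d-th roots of unity *)

Section PowerSums.
Variable K : numFieldType.
Variables (d : nat) (w : K).
Hypotheses (wd : w ^+ d = 1) (w_prim : forall p, (0 < p < d)%N -> w ^+ p != 1).

Lemma sum_root_pow p : \sum_(j < d) (w ^+ p) ^+ j = if (d %| p)%N then d%:R else 0.
Proof.
case: ifPn => dp.
  rewrite (eq_bigr (fun=> 1)) ?sumr_const ?card_ord // => j _.
  by rewrite -(divnK dp) mulnC exprM wd !expr1n.
have [d0|d0] := posnP d; first by rewrite [in LHS]d0 big_ord0.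
have w1 : w ^+ p != 1.
  rewrite -(expr_mod _ wd); apply: w_prim.
  by rewrite ltn_mod d0 andbT lt0n.
apply: (mulfI (x := w ^+ p - 1)); first by rewrite subr_eq0.
by rewrite -subrX1 mulr0 exprAC wd expr1n subrr.
Qed.
End PowerSums.

Section RootSum.
Variable K : numFieldType.
Variables (d m : nat) (w z : K) (F : fps K).
Hypotheses (wd : w ^+ d = 1) (w_prim : forall p, (0 < p < d)%N -> w ^+ p != 1).
Hypotheses (m0 : (0 < m)%N) (md : (m < d)%N) (z0 : z != 0) (zd : z ^+ d != 1).
Local Notation E := (fexp (1 : K)).
Hypothesis FE : F * (fconst (z ^- d) * E ^+ d - 1) = 1.

Let x (j : nat) := z * w ^+ j.
Let xd j : x j ^+ d = z ^+ d.
Proof. by rewrite exprMn exprAC wd expr1n mulr1. Qed.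

Let x1 j : x j != 1.
Proof. by apply: contraNneq zd => xj; rewrite -(xd j) xj expr1n. Qed.

(** The partial fraction expansion of [d x^(m-1) / (z^-d x^d - 1)], multiplied by [x],
    at [x = e^X].  The quotient [(x^d - z^d) / (x - x_j)] is the sum of the [x^(d-1-i) x_j^i], and after
    multiplication by [x_j^m] and summation over [j] only [i = d - m] survives. *)
Lemma sum_root_pole :
  \sum_(j < d) fconst (x j ^+ m) * (E * fps_inv (E - fconst (x j)))
  = fconst d%:R * (E ^+ m * F).
Proof.
have zd0 : z ^+ d != 0 by rewrite expf_neq0.
have pole j : E * fps_inv (E - fconst (x j)) =
    fconst (z ^- d) * F * E * \sum_(i < d) E ^+ (d.-1 - i) * fconst (x j ^+ i).
  have inv : (E - fconst (x j)) * fps_inv (E - fconst (x j)) = 1.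
    rewrite mul_fps_inv // fcoefB.
    by rewrite /= expr0 fact0 divr1 subr_eq0 eq_sym x1.
  have -> : \sum_(i < d) E ^+ (d.-1 - i) * fconst (x j ^+ i) =
     (E ^+ d - fconst (z ^+ d)) * fps_inv (E - fconst (x j)).
    rewrite -(xd j) rmorphXn subrXX -[LHS]mul1r -inv /=.
    rewrite (eq_bigr (fun i : 'I_d => E ^+ (d.-1 - i) * fconst (x j) ^+ i)); first by ring.
    by move=> i _; rewrite rmorphXn.
  have -> : E ^+ d - fconst (z ^+ d) = fconst (z ^+ d) * (fconst (z ^- d) * E ^+ d - 1).
    by rewrite mulrBr mulrA -rmorphM divff // rmorph1; ring.
  set g := fps_inv _; set Q := _ - 1.
  have -> : fconst (z ^- d) * F * E * (fconst (z ^+ d) * Q * g) =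
    fconst (z ^- d) * fconst (z ^+ d) * (F * Q) * (E * g) by ring.
  by rewrite -rmorphM mulVf // rmorph1 FE !mul1r.
under eq_bigr => j _ do rewrite pole mulrCA mulr_sumr.
rewrite -mulr_sumr exchange_big /=.
have inner i A : \sum_(j < d) fconst (x j ^+ m) * (A * fconst (x j ^+ i)) =
    A * fconst (z ^+ (m + i) * if (d %| m + i)%N then d%:R else 0).
  rewrite -(sum_root_pow wd w_prim) mulr_sumr rmorph_sum mulr_sumr.
  apply: eq_bigr => j _; rewrite mulrCA -rmorphM -exprD exprMn.
  by congr (_ * fconst (_ * _)); rewrite exprAC.
under eq_bigr => i _ do rewrite inner.
have dm : (d - m < d)%N by lia.
rewrite (bigD1 (Ordinal dm)) //= big1 ?addr0 => [|i idm].
  rewrite subnKC 1?ltnW // dvdnn rmorphM.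
  rewrite (_ : (d.-1 - (d - m) = m.-1)%N); last by lia.
  have -> : fconst (z ^- d) * F * E * (E ^+ m.-1 * (fconst (z ^+ d) * fconst d%:R)) =
     (fconst (z ^- d) * fconst (z ^+ d)) * fconst d%:R * (E * E ^+ m.-1 * F) by ring.
  by rewrite -rmorphM mulVf // rmorph1 mul1r -exprS prednK.
case: ifP => [|_]; last by rewrite mulr0 rmorph0 mulr0.
case/dvdnP => q mi; case/negP: idm; apply/eqP/val_inj => /=.
have := ltn_ord i; case: q mi => [|[|q]]; rewrite ?mulSn; lia.
Qed.

(** The sum of [x_j^m (1 - h(x_j)^n)] is a sum of the residues of [fcoth_pole]; the
    part with the constant [1] vanishes because [d] does not divide [m]. *)
Lemma sum_root_coth n :
  \sum_(j < d) w ^+ (m * j) * ((x j + 1) / (x j - 1)) ^+ n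
  = - (z ^- m * d%:R * (fX * fcoth K ^+ n * E ^+ m * F) n).
Proof.
have zm : z ^+ m != 0 by rewrite expf_neq0.
have inv j : fps_inv (E - fconst (x j)) * (E - fconst (x j)) = 1.
  rewrite mulrC mul_fps_inv // fcoefB.
  by rewrite /= expr0 fact0 divr1 subr_eq0 eq_sym x1.
have x_m j : x j ^+ m = z ^+ m * w ^+ (m * j) by rewrite exprMn mulnC exprM.
have sum_xm : \sum_(j < d) x j ^+ m = 0.
  rewrite (eq_bigr (fun j : 'I_d => z ^+ m * (w ^+ m) ^+ j)) => [|j _].
    rewrite -mulr_sumr (sum_root_pow wd w_prim) ifF ?mulr0 //.
    by apply/negP => /dvdn_leq; lia.
  by rewrite x_m exprM.
have := congr1 (fun f => (fX * fcoth K ^+ n * f) n) sum_root_pole.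
rewrite mulr_sumr fcoef_sum.
rewrite (eq_bigr (fun j : 'I_d => x j ^+ m - x j ^+ m * ((x j + 1) / (x j - 1)) ^+ n)); last first.
  move=> j _; rewrite mulrCA fcoefCM !mulrA (fcoth_pole _ (x1 j)) ?inv //.
  by rewrite mulrBr mulr1.
rewrite sumrB sum_xm sub0r mulrCA fcoefCM !mulrA => /eqP.
rewrite eqr_oppLR => /eqP e.
apply: (mulfI zm); rewrite mulrN !mulrA divff // mul1r -e mulr_sumr.
by apply: eq_bigr => j _; rewrite x_m mulrA.
Qed.
End RootSum.

Section Agree.
Variable K : comNzRingType.
(** The coefficient [n] of a product depends only on the coefficients up to [n] of the
    factors, so each factor may be replaced by a finite sum of monomials. *)
Definition agree (N : nat) (f g : fps K) := forall k, (k <= N)%N -> f k = g k.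

Lemma agreeM N f g f' g' : agree N f f' -> agree N g g' -> agree N (f * g) (f' * g').
Proof.
move=> ff gg k kN; rewrite !fcoefM; apply: eq_bigr => i _.
by rewrite ff ?gg //; have := ltn_ord i; lia.
Qed.

Lemma agreeX N f g n : agree N f g -> agree N (f ^+ n) (g ^+ n).
Proof. by move=> fg; elim: n => [|n IH] //; rewrite !exprS; apply: agreeM. Qed.

Lemma fcoef_mono c a k : (fconst c * fX ^+ a : fps K) k = c * (k == a)%:R.
Proof.
rewrite fcoefCM; congr (_ * _); elim: a k => [|a IH] k; first by [].
by rewrite exprS; case: k => [|k]; rewrite ?fcoefXM0 ?fcoefXM ?IH.
Qed.

Lemma prod_mono n (c : 'I_n -> K) (a : 'I_n -> nat) :
  \prod_(r < n) (fconst (c r) * fX ^+ a r) =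
  fconst (\prod_(r < n) c r) * fX ^+ (\sum_(r < n) a r)%N.
Proof.
by rewrite big_split /= -(rmorph_prod (@fconst K)) -(big_morph _ (exprD _) (expr0 _)).
Qed.

Lemma agree_sum n f : agree n f (\sum_(i < n.+1) fconst (f i) * fX ^+ i).
Proof.
move=> k kn; rewrite fcoef_sum.
have kn' : (k < n.+1)%N by rewrite ltnS.
rewrite (bigD1 (Ordinal kn')) // big1 => [|i ik].
  by rewrite fcoef_mono eqxx mulr1 /= addr0.
rewrite fcoef_mono (_ : (k == i) = false) ?mulr0 //.
by apply: contraNF ik => /eqP ki; apply/eqP/val_inj.
Qed.

Lemma agree_even n (f : fps K) : (forall k, odd k -> f k = 0) ->
  agree n f (\sum_(i < n.+1) fconst (f (2 * i)%N) * fX ^+ (2 * i)).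
Proof.
move=> fo k kn; rewrite fcoef_sum.
have [ok|ek] := boolP (odd k).
  rewrite fo // big1 // => i _; rewrite fcoef_mono (_ : (k == _) = false) ?mulr0 //.
  by lia.
have kn' : (k./2 < n.+1)%N by lia.
rewrite (bigD1 (Ordinal kn')) // big1 => [|i ik].
  by rewrite fcoef_mono (_ : (2 * Ordinal kn')%N = k) ?eqxx ?mulr1 /= ?addr0 //; lia.
rewrite fcoef_mono (_ : (k == _) = false) ?mulr0 //.
apply: contraNF ik => /eqP ki; apply/eqP/val_inj => /=; lia.
Qed.

(** Only the even-indexed coefficients of [f] are kept, which is why the
    indices [j r] enter doubled. *)
Lemma fcoef_prod_expand n (f g l : fps K) : (0 < n)%N ->
  (forall k, odd k -> f k = 0) ->
  (fX * f ^+ n * g * l) n =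
  \sum_(j : {ffun 'I_n -> 'I_n}) \sum_(mu < n) \sum_(nu < n
     | ((\sum_(r < n) 2 * j r) + mu + nu == n - 1)%N)
    g mu * l nu * \prod_(r < n) f (2 * j r)%N.
Proof.
case: n => // n _ fo; rewrite -!mulrA fcoefXM mulrA.
have fgl := agreeM (agreeM (agreeX n.+1 (agree_even (n := n) fo)) (@agree_sum n g))
  (@agree_sum n l).
rewrite (fgl n (leqnn n)).
set P := \sum_(i < n.+1) fconst (f _) * _.
have -> : P ^+ n.+1 = \prod_(r < n.+1) P by rewrite prodr_const card_ord.
rewrite bigA_distr_bigA -mulrA mulr_suml fcoef_sum; apply: eq_bigr => j _.
rewrite mulr_suml mulr_sumr fcoef_sum; apply: eq_bigr => mu _.
rewrite !mulr_sumr fcoef_sum [RHS]big_mkcond; apply: eq_bigr => nu _.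
rewrite (prod_mono (fun r => f (2 * j r)%N) (fun r => 2 * j r)%N).
set c := \prod_(r < _) _; set S := (\sum_(r < _) _)%N.
have -> : fconst c * fX ^+ S * (fconst (g mu) * fX ^+ mu * (fconst (l nu) * fX ^+ nu))
  = fconst (g mu * l nu * c) * fX ^+ (S + mu + nu).
  by rewrite !exprD !rmorphM; ring.
rewrite fcoef_mono subn1 /= eq_sym.
by case: eqP; rewrite ?mulr1 ?mulr0.
Qed.
End Agree.

(** * Convergence of complex power series *)

Section Analysis.
Local Open Scope classical_set_scope.
Local Open Scope complex_scope.
Local Open Scope ring_scope.
Variable R : realType.
Local Notation C := (R[i]).
Implicit Types (u v : nat -> C) (l : C) (f g : fps C).

Definition cvgC u l : Prop := (u : nat -> C^o) @ \oo --> (l : C^o).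

Lemma pos_real (e : C) : 0 < e -> exists2 r : R, 0 < r & e = r%:C.
Proof.
case: e => r i; rewrite ltcE /= => /andP[/eqP -> r0]; by exists r.
Qed.

(** A complex sequence is controlled through real errors, since a positive complex
    number is a positive real number. *)
Lemma cvgC_dom u l (e : nat -> R) : (forall n, `|u n - l| <= (e n)%:C) ->
  e @ \oo --> (0 : R) -> cvgC u l.
Proof.
move=> ue /cvgrPdist_lt e0; apply/cvgrPdist_lt => eps /pos_real[r r0 ->].
have := e0 _ r0; apply: filterS => n; rewrite sub0r normrN => er.
rewrite distrC; apply: le_lt_trans (ue n) _; rewrite ltcR.
exact: le_lt_trans (ler_norm _) er.
Qed.

Lemma normc_real (x : R) : `|x%:C| = `|x|%:C.
Proof. by rewrite normc_def /= expr0n addr0 sqrtr_sqr. Qed.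

Lemma cvgC_real (x_ : nat -> R) (x : R) : x_ @ \oo --> x ->
  cvgC (fun n => (x_ n)%:C) x%:C.
Proof.
move=> xx; apply: (@cvgC_dom _ _ (fun n => `|x_ n - x|)) => [n|].
  by rewrite -rmorphB normc_real.
by rewrite -(normr0 R); apply: cvg_norm; rewrite -(subrr x); apply: cvgB => //; exact: cvg_cst.
Qed.

Lemma cvgC_D u v l l' : cvgC u l -> cvgC v l' -> cvgC (fun n => u n + v n) (l + l').
Proof. exact: cvgD. Qed.

Lemma cvgC_B u v l l' : cvgC u l -> cvgC v l' -> cvgC (fun n => u n - v n) (l - l').
Proof. exact: cvgB. Qed.

Lemma cvgC_M u v l l' : cvgC u l -> cvgC v l' -> cvgC (fun n => u n * v n) (l * l').
Proof. exact: (@cvgM C). Qed.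

Lemma cvgC_cst l : cvgC (fun=> l) l.
Proof. exact: cvg_cst. Qed.

Arguments cvgC_cst : clear implicits.

Lemma cvgC_sub0 u l : cvgC u l -> cvgC (fun n => u n - l) 0.
Proof. by move=> ul; have := cvgC_B ul (cvgC_cst l); rewrite subrr. Qed.

Lemma cvgC_unique u l l' : cvgC u l -> cvgC u l' -> l = l'.
Proof. by apply: cvg_unique; exact: norm_hausdorff. Qed.

Lemma cvgC_ext u v l : (forall n, u n = v n) -> cvgC u l -> cvgC v l.
Proof. by move=> uv; have -> : v = u by apply/funext. Qed.

Lemma cvgC_Sn u l : cvgC (fun n => u n.+1) l -> cvgC u l.
Proof. by move=> h; rewrite /cvgC -cvg_shiftS. Qed.

Lemma cvgC_shift u l : cvgC u l -> cvgC (fun n => u n.+1) l.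
Proof. by rewrite /cvgC -cvg_shiftS. Qed.

Lemma cvgC_small u l eps : cvgC u l -> 0 < eps ->
  exists N0, forall n, (N0 <= n)%N -> `|u n - l| < eps.
Proof.
move=> /cvgrPdist_lt ul e0; have [N _ NN] := ul _ e0.
by exists N => n Nn; rewrite distrC; exact: NN.
Qed.

Lemma cvgC_bounded u l : cvgC u l -> exists M : C, forall n, `|u n| <= M.
Proof.
move=> ul; have : cvgn (u : nat -> C^o) by apply/cvg_ex; exists l.
move=> /cvg_seq_bounded -[M [Mr MM]]; exists (M + 1) => n.
by apply: (MM (M + 1)) => //; rewrite ltrDl.
Qed.

(** The partial sums in [power_series_at0], to which these are convertible. *)
Definition psum f (z : C) : nat -> C := fun N => \sum_(0 <= k < N) f k * z ^+ k.

Lemma horner_trunc f z N : (\poly_(i < N) f i).[z] = psum f z N.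
Proof. by rewrite horner_poly /psum big_mkord. Qed.

Lemma expn2_sq N : (N * N <= 4 ^ N)%N.
Proof.
have := ltn_expl N (isT : (1 < 2)%N) => h.
by rewrite (_ : 4 = 2 * 2)%N // expnMn leq_mul // ltnW.
Qed.

(** The product of the partial sums differs from the partial sum of the product by the
    terms of total degree from [N] to [2 N], at most [2 N^2] of size [O(8^-N)], and
    [N^2 <= 4^N]. *)
Lemma cauchy_product f g z (a b : R) : 0 <= a -> 0 <= b ->
  (forall k, `|f k * z ^+ k| <= (a / 8 ^+ k)%:C) ->
  (forall k, `|g k * z ^+ k| <= (b / 8 ^+ k)%:C) ->
  cvgC (fun N => psum f z N * psum g z N - psum (f * g) z N) 0.
Proof.
move=> a0 b0 fa gb.
pose P N := \poly_(i < N) f i; pose Q N := \poly_(i < N) g i.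
have PQ N : psum f z N * psum g z N - psum (f * g) z N =
    \sum_(N <= k < N + N) (P N * Q N)`_k * z ^+ k.
  rewrite -!horner_trunc -/(P N) -/(Q N) -hornerM (@horner_coef_wide _ (N + N)); last first.
    apply: leq_trans (size_polyMleq _ _) _; apply: leq_trans (leq_pred _) _.
    by apply: leq_add; exact: size_poly.
  rewrite -(big_mkord xpredT (fun k => (P N * Q N)`_k * z ^+ k)).
  rewrite (big_cat_nat (leq0n N) (leq_addr N N)) horner_trunc /= /psum.
  rewrite [X in X + _ - _](_ : _ = psum (f * g) z N); first by rewrite addrAC subrr add0r.
  apply: eq_big_nat => k /andP[_ kN]; congr (_ * _).
  rewrite coefM fcoefM; apply: eq_bigr => i _; rewrite !coef_poly.
  by have := ltn_ord i => ik; rewrite !ifT //; lia.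
have coefb k N : `|(P N * Q N)`_k * z ^+ k| <= ((a * b) / 8 ^+ k *+ k.+1)%:C.
  rewrite coefM mulr_suml; apply: le_trans (ler_norm_sum _ _ _) _.
  rewrite (_ : (a * b / 8 ^+ k *+ k.+1)%:C =
      \sum_(i < k.+1) (a / 8 ^+ i)%:C * (b / 8 ^+ (k - i))%:C).
    apply: ler_sum => i _.
    have ik : (i <= k)%N by rewrite -ltnS.
    rewrite (_ : z ^+ k = z ^+ i * z ^+ (k - i)); last by rewrite -exprD subnKC.
    rewrite mulrACA normrM; apply: ler_pM => //.
      rewrite coef_poly; case: ifP => // _.
      by rewrite mul0r normr0 ler0c divr_ge0 // exprn_ge0.
    rewrite coef_poly; case: ifP => // _.
    by rewrite mul0r normr0 ler0c divr_ge0 // exprn_ge0.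
  rewrite (eq_bigr (fun=> (a * b / 8 ^+ k)%:C)) => [|i _].
    by rewrite sumr_const card_ord rmorphMn.
  have ik : (i <= k)%N by rewrite -ltnS.
  by rewrite -rmorphM mulrACA -invfM -exprD subnKC.
apply: (@cvgC_dom _ _ (fun N => (2 * a * b) * (1 / 2) ^+ N)) => [N|]; last first.
  rewrite -(mulr0 (2 * a * b)); apply: cvgM; first exact: cvg_cst.
  by apply: cvg_expr; rewrite ger0_norm ?divr_ge0 // ltr_pdivrMr // mul1r ltr1n.
rewrite subr0 PQ; apply: le_trans (ler_norm_sum _ _ _) _.
apply: (@le_trans _ _ (\sum_(N <= k < N + N) ((a * b) / 8 ^+ N *+ (N + N))%:C)).
  apply: ler_sum_nat => k /andP[Nk kN]; apply: le_trans (coefb k N) _.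
  rewrite lecR.
  apply: (@le_trans _ _ (a * b / 8 ^+ k *+ (N + N))).
    by apply: ler_wpMn2l => //; rewrite divr_ge0 ?mulr_ge0 // exprn_ge0.
  rewrite lerMn2r; apply/orP; right.
  apply: ler_wpM2l; first exact: mulr_ge0.
  rewrite lef_pV2 ?posrE ?exprn_gt0 //.
  by apply: ler_weXn2l => //; rewrite ler1n.
rewrite sumr_const_nat addnK -rmorphMn lecR -mulrnA -[leLHS]mulr_natr.
have h : ((N + N) * N)%:R <= 2 * 4 ^+ N :> R.
  by rewrite -natrX -natrM ler_nat addnn -mul2n -mulnA leq_mul2l expn2_sq.
apply: le_trans (ler_wpM2l _ h) _; first by rewrite divr_ge0 ?mulr_ge0 // exprn_ge0.
have -> : (1 / 2 : R) ^+ N = 4 ^+ N / 8 ^+ N.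
  by rewrite -expr_div_n; congr (_ ^+ _); field.
by rewrite le_eqVlt; apply/orP; left; apply/eqP; ring.
Qed.

End Analysis.
Arguments cvgC_cst {R} l.

(** * Uniqueness of expansions and expansions of reciprocals *)

Section Series.
Local Open Scope classical_set_scope.
Local Open Scope complex_scope.
Local Open Scope ring_scope.
Variable R : realType.
Local Notation C := (R[i]).
Implicit Types (u v : nat -> C) (l : C) (f g : fps C).

Lemma near0_intro (P : C -> Prop) (r : R) : 0 < r ->
  (forall z, z != 0 -> `|z| <= r%:C -> P z) -> \forall z \near (0 : C^o)^', P z.
Proof.
move=> r0 rP; have rC : (0 : C) < r%:C by rewrite ltcR.
have := @dnbhs0_le C C^o _ rC; apply: filterS2 (nbhs_dnbhs_neq (0 : C^o)) => z z0.
exact: rP.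
Qed.

Lemma near0_elim (P : C -> Prop) : (\forall z \near (0 : C^o)^', P z) ->
  exists2 r : R, 0 < r & forall z, z != 0 -> `|z| < r%:C -> P z.
Proof.
move=> /nbhs_ballP[e /pos_real[r r0 ->]] rP; exists r => // z z0 zr.
by apply: rP => //; rewrite /ball /= sub0r normrN.
Qed.

Lemma psumB f g z N : psum (f - g) z N = psum f z N - psum g z N.
Proof. by rewrite /psum -sumrB; apply: eq_bigr => k _; rewrite mulrBl. Qed.

Lemma psumC c f z N : psum (fconst c * f) z N = c * psum f z N.
Proof. by rewrite /psum mulr_sumr; apply: eq_bigr => k _; rewrite fcoefCM mulrA. Qed.

Lemma psum1 (z : C) N : psum 1 z N.+1 = 1.
Proof.
rewrite /psum big_mkord big_ord_recl mulr1 big1 ?addr0 // => i _.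
by rewrite mul0r.
Qed.

Lemma cvgC_psum1 (z : C) : cvgC (psum 1 z) 1.
Proof.
apply: (@cvgC_Sn R); rewrite (_ : (fun n => _) = fun=> (1 : C)); first exact: cvgC_cst.
by apply/funext => n; rewrite psum1.
Qed.

Lemma cvgC_bounded_mul u v (M : R) : (forall n, `|u n| <= M%:C) -> cvgC v 0 ->
  cvgC (fun n => u n * v n) 0.
Proof.
move=> uM v0; have M0 : 0 <= M by rewrite -lecR; exact: le_trans (normr_ge0 _) (uM 0%N).
apply/cvgrPdist_lt => eps e0.
have M1 : (0 : C) < (1 + M)%:C by rewrite ltcR ltr_wpDr.
have /cvgrPdist_lt/(_ (eps / (1 + M)%:C)) := v0; rewrite divr_gt0 // => /(_ isT).
apply: filterS => n; rewrite !sub0r !normrN normrM ltr_pdivlMr // => vn.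
apply: le_lt_trans vn; rewrite mulrC ler_wpM2l //; apply: le_trans (uM n) _.
by rewrite lecR lerDr.
Qed.

Lemma geo_sum_le (K : numFieldType) (q : K) m n : 0 <= q -> q <= 1 / 2 ->
  \sum_(m <= k < n) q ^+ k <= 2 * q ^+ m.
Proof.
move=> q0 q2.
have h p : \sum_(0 <= k < p) q ^+ k <= 2.
  elim: p => [|p IH]; first by rewrite big_geq.
  rewrite big_nat_recl // expr0.
  under eq_bigr => k _ do rewrite exprS.
  rewrite -mulr_sumr; apply: (@le_trans _ _ (1 + 1 / 2 * 2)); last first.
    by rewrite divfK ?pnatr_eq0 // -mulr2n.
  by rewrite lerD2l ler_pM // sumr_ge0 // => k _; rewrite exprn_ge0.
rewrite -{1}[m]add0n big_addn mulrC.
under eq_bigr => k _ do rewrite exprD mulrC.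
by rewrite -mulr_sumr ler_wpM2l // exprn_ge0.
Qed.

Lemma le_small_eq0 (K : numFieldType) (x D : K) : 0 <= x -> 0 < D ->
  (forall q, 0 < q -> q <= 1 / 2 -> x <= D * q) -> x = 0.
Proof.
move=> x0 D0 small; apply/eqP; case: (eqVneq x 0) => // xn0; exfalso.
have xp : 0 < x by rewrite lt_neqAle eq_sym xn0.
have Dx : 0 < D + x by exact: addr_gt0.
have Dx2 : 0 < 2 * (D + x) by exact: mulr_gt0.
have q2 : x / (2 * (D + x)) <= 1 / 2.
  by rewrite ler_pdivrMr // mulrA divfK ?pnatr_eq0 // mul1r lerDr ltW.
have := small _ (divr_gt0 xp Dx2) q2; rewrite mulrA ler_pdivlMr // mulrC ler_pM2r //.
apply/negP; rewrite -real_ltNge ?gtr0_real //.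
by rewrite mulrDr mulr_natl mulr2n -addrA ltrDl addr_gt0 // mulr_gt0.
Qed.

(** If the difference series [c] tends to [0] near [0] and [c_0, ..., c_(k-1)] vanish, then
    at the point [s q] the term of degree [k] is, up to a null sequence, the negative
    of the tail, which is [O(q^(k+1))] with a constant independent of [q]; let [q]
    tend to [0]. *)
Lemma psum_unique (f g : C -> C) (a b : nat -> C) :
  (\forall z \near (0 : C^o)^', f z = g z) ->
  power_series_at0 f a -> power_series_at0 g b -> a = b.
Proof.
move=> fg fa gb.
have /near0_elim[r r0 rab] : \forall z \near (0 : C^o)^', cvgC (psum (Fps a - Fps b) z) 0.
  apply: filterS3 fg fa gb => z fgz faz gbz.
  rewrite (_ : psum _ _ = fun N => psum (Fps a) z N - psum (Fps b) z N); last first.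
    by apply/funext => N; rewrite psumB.
  have fa' : cvgC (psum (Fps a) z) (f z) := faz.
  have gb' : cvgC (psum (Fps b) z) (g z) := gbz.
  by rewrite -[0](subrr (f z)) {2}fgz; exact: cvgC_B fa' gb'.
set c := Fps a - Fps b in rab.
have cE k : c k = a k - b k by [].
clearbody c.
pose s : C := (r / 2)%:C.
have s0 : 0 < s by rewrite ltcR divr_gt0.
have sr : s < r%:C by rewrite ltcR ltr_pdivrMr // mulr_natr mulr2n ltrDl.
have [B Bc] : exists B : C, forall k, `|c k * s ^+ k| <= B.
  have cs : cvgC (psum c s) 0 by apply: rab; rewrite ?gt_eqF // ger0_norm // ltW.
  have [M Mc] := cvgC_bounded cs; exists (M + M) => k.
  have -> : c k * s ^+ k = psum c s k.+1 - psum c s k.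
    by rewrite /psum big_nat_recr // [RHS]addrC addKr.
  by apply: le_trans (ler_normB _ _) _; exact: lerD.
have B0 : 0 <= B by exact: le_trans (normr_ge0 _) (Bc 0).
suff c0 k : c k = 0.
  apply/funext => k; apply/eqP; rewrite -subr_eq0; by rewrite -cE c0.
elim/ltn_ind: k => k IH.
have small (q : C) : 0 < q -> q <= 1 / 2 -> `|c k * s ^+ k| <= (1 + 2 * B) * q.
  move=> q0 q2.
  have q1 : q <= 1 by apply: le_trans q2 _; rewrite ler_pdivrMr // mul1r ler1n.
  have csq : cvgC (psum c (s * q)) 0.
    apply: rab; first by rewrite mulf_neq0 ?gt_eqF.
    rewrite normrM !gtr0_norm //; apply: le_lt_trans sr.
    by rewrite ler_piMr // ltW.
  have [N0 hN] := cvgC_small csq (exprn_gt0 k.+1 q0).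
  pose N := (N0 + k.+1)%N.
  have := hN N (leq_addr _ _); rewrite subr0 => psmall.
  have e : psum c (s * q) N = c k * s ^+ k * q ^+ k
      + \sum_(k.+1 <= i < N) c i * s ^+ i * q ^+ i.
    rewrite /psum (big_cat_nat (leq0n k.+1) (leq_addl _ _)) /= big_nat_recr //=.
    rewrite big_nat_cond big1 ?add0r => [|i /andP[/andP[_ ik] _]]; last first.
      by rewrite IH // mul0r.
    rewrite exprMn mulrA; congr (_ + _).
    by apply: eq_bigr => i _; rewrite exprMn mulrA.
  have tail : `|\sum_(k.+1 <= i < N) c i * s ^+ i * q ^+ i| <= B * (2 * q ^+ k.+1).
    apply: le_trans (ler_norm_sum _ _ _) _.
    apply: le_trans (ler_wpM2l B0 (geo_sum_le k.+1 N (ltW q0) q2)).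
    rewrite mulr_sumr; apply: ler_sum => i _; rewrite normrM.
    by rewrite ler_pM // normrX gtr0_norm.
  have : `|c k * s ^+ k| * q ^+ k <= (1 + 2 * B) * q * q ^+ k.
    rewrite -{1}(gtr0_norm q0) -normrX -normrM.
    rewrite (_ : c k * s ^+ k * q ^+ k = psum c (s * q) N
       - \sum_(k.+1 <= i < N) c i * s ^+ i * q ^+ i); last by rewrite e addrK.
    apply: le_trans (ler_normB _ _) _.
    rewrite -mulrA -exprS mulrDl mul1r; apply: lerD; first exact: ltW.
    by rewrite mulrAC [2 * _ * _]mulrC in tail *.
  by rewrite ler_pM2r // exprn_gt0.
have ck : `|c k * s ^+ k| = 0.
  by apply: le_small_eq0 small; rewrite // ltr_wpDr // mulr_ge0.
move/eqP: ck; rewrite normr_eq0 mulf_eq0 expf_eq0 (gt_eqF s0) andbF orbF.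
by move/eqP.
Qed.

Lemma coefs_at0E (f : C -> C) (a : nat -> C) : power_series_at0 f a -> coefs_at0 f = a.
Proof.
move=> fa; apply: (@psum_unique f f) => //; first exact: nearW.
by rewrite /coefs_at0; case: xgetP => [b -> //|/(_ a)].
Qed.

Definition bounded_coefs f := exists B : R, forall k, `|f k| <= B%:C.

Lemma norm_real (z : C) : exists2 x : R, 0 <= x & `|z| = x%:C.
Proof. by rewrite normc_def; eexists; last reflexivity; exact: sqrtr_ge0. Qed.

Lemma geo_term f (a G : R) z : 0 < G -> (forall k, `|f k| <= (a * G ^+ k)%:C) ->
  `|z| <= (1 / (8 * G))%:C -> forall k, `|f k * z ^+ k| <= (a / 8 ^+ k)%:C.
Proof.
move=> G0 fG zG k; rewrite normrM normrX.
have -> : a / 8 ^+ k = a * G ^+ k * (1 / (8 * G)) ^+ k.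
  by rewrite expr_div_n expr1n exprMn; field; rewrite !expf_neq0 // ?gt_eqF.
rewrite rmorphM rmorphXn; apply: ler_pM => //; first exact: exprn_ge0.
by rewrite lerXn2r // ?nnegrE // (le_trans _ zG).
Qed.

(** The recurrence for the coefficients of [1 / f] bounds each of them by [q B] times
    the sum of the preceding ones, where [q = 1 / |f(0)|]; this sum grows at most
    like the powers of [1 + q B]. *)
Lemma inv_geo f : f 0 != 0 -> bounded_coefs f -> exists q G : R,
  [/\ 0 <= q, 1 <= G & forall k, `|fps_inv f k| <= (q * G ^+ k)%:C].
Proof.
move=> f0 [B fB]; have [q q0 qE] := norm_real (f 0)^-1.
have B0 : 0 <= B by rewrite -lecR; exact: le_trans (normr_ge0 _) (fB 0).
exists q, (1 + q * B); have G1 : 1 <= 1 + q * B by rewrite lerDl mulr_ge0.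
split=> //; elim/ltn_ind => k IH.
have := congr1 (fun g : fps C => g k) (mul_fps_inv f0).
rewrite fcoefM fcoef1 big_ord_recl subn0 => h.
have -> : fps_inv f k = (f 0)^-1 *
    ((k == 0)%:R - \sum_(i < k) f (bump 0 i) * fps_inv f (k - bump 0 i)%N).
  by rewrite -h addrK mulKf.
rewrite normrM qE rmorphM ler_wpM2l ?ler0c //.
case: k IH {h} => [|k] IH.
  by rewrite big_ord0 subr0 normr1 expr0.
rewrite sub0r normrN; apply: le_trans (ler_norm_sum _ _ _) _.
apply: (@le_trans _ _ (\sum_(i < k.+1) B%:C * (q * (1 + q * B) ^+ (k - i))%:C)).
  apply: ler_sum => i _; rewrite normrM; apply: ler_pM => //.
  by rewrite /bump /= add1n subSS; apply: IH; lia.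
rewrite -mulr_sumr -rmorph_sum -rmorphM lecR -mulr_sumr.
rewrite (reindex_inj rev_ord_inj) /=.
rewrite (eq_bigr (fun i : 'I_k.+1 => (1 + q * B) ^+ i)); last first.
  by move=> i _; congr (_ ^+ _); have := ltn_ord i; lia.
have e : q * B * \sum_(i < k.+1) (1 + q * B) ^+ i = (1 + q * B) ^+ k.+1 - 1.
  by rewrite subrX1 addrAC subrr add0r.
by rewrite mulrA [B * q]mulrC e gerBl.
Qed.

(** By [cauchy_product] the partial sums of the formal inverse times those of [f] tend
    to [1].  As the former are bounded, the latter may be replaced by their limit
    [g z], which is therefore nonzero, and one divides by it. *)
Lemma power_series_inv (g : C -> C) f : f 0 != 0 -> bounded_coefs f ->
  power_series_at0 g f -> power_series_at0 (fun z => (g z)^-1) (fps_inv f).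
Proof.
move=> f0 fb gf; have [q [G [q0 G1 aG]]] := inv_geo f0 fb.
have G0 : 0 < G by exact: lt_le_trans G1.
have [B fB] := fb.
have B0 : 0 <= B by rewrite -lecR; exact: le_trans (normr_ge0 _) (fB 0).
have r0 : 0 < 1 / (8 * G) by rewrite divr_gt0 // mulr_gt0.
apply: filterS2 gf (near0_intro r0 (fun z _ zr => zr)) => z gz zr.
have fz := @geo_term f B 1 z ltr01.
have az := geo_term G0 aG zr.
have {}fz : forall k, `|f k * z ^+ k| <= (B / 8 ^+ k)%:C.
  apply: fz => [k|]; first by rewrite expr1n mulr1.
  apply: le_trans zr _; rewrite lecR !div1r lef_pV2 ?posrE ?mulr_gt0 //.
  by rewrite ler_wpM2l.
have prod1 : cvgC (fun N => psum (fps_inv f) z N * psum f z N) 1.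
  have := cvgC_D (cauchy_product q0 B0 az fz) (cvgC_psum1 z).
  have -> : fps_inv f * f = 1 by rewrite mulrC mul_fps_inv.
  by rewrite add0r; apply: cvgC_ext => N; rewrite subrK.
have bnd N : `|psum (fps_inv f) z N| <= (2 * q)%:C.
  apply: le_trans (ler_norm_sum _ _ _) _.
  apply: (@le_trans _ _ (\sum_(0 <= k < N) (q / 8 ^+ k)%:C)).
    by apply: ler_sum => k _.
  rewrite -rmorph_sum lecR -mulr_sumr mulrC ler_wpM2r //.
  rewrite (eq_bigr (fun k => (1 / 8) ^+ k)); last by move=> k _; rewrite div1r exprVn.
  have := @geo_sum_le R (1 / 8) 0 N; rewrite expr0 mulr1; apply; lra.
have err : cvgC (fun N => psum (fps_inv f) z N * (psum f z N - g z)) 0.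
  have d0 : cvgC (fun N => psum f z N - g z) 0. by exact: (@cvgC_sub0 R (psum f z)).
  exact: (cvgC_bounded_mul bnd d0).
have lim : cvgC (fun N => psum (fps_inv f) z N * g z) 1.
  have := cvgC_B prod1 err; rewrite subr0.
  by apply: cvgC_ext => N; ring.
have gz0 : g z != 0.
  apply/eqP => g0; have lim0 : cvgC (fun N => psum (fps_inv f) z N * g z) 0.
    by rewrite g0; apply: (@cvgC_ext R _ _ 0 _ (cvgC_cst 0)) => N; rewrite mulr0.
  by have /eqP := cvgC_unique lim lim0; rewrite oner_eq0.
have := cvgC_M lim (cvgC_cst (g z)^-1); rewrite mul1r.
by apply: cvgC_ext => N; rewrite mulfK.
Qed.

End Series.

(** * The expansions behind A, the Bernoulli numbers and C *)

Section ExpSeries.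
Local Open Scope classical_set_scope.
Local Open Scope complex_scope.
Local Open Scope ring_scope.
Variable R : realType.
Local Notation C := (R[i]).

Lemma Im_le_norm (z : C) : `|complex.Im z|%:C <= `|z|.
Proof.
rewrite normc_def lecR -sqrtr_sqr ler_sqrt ?lerDr ?sqr_ge0 //.
by rewrite addr_ge0 ?sqr_ge0.
Qed.

Lemma cvgC_series (u_ : nat -> R) : cvgn (series u_) ->
  cvgC (fun N => (series u_ N)%:C) (limn (series u_))%:C.
Proof. by move=> h; exact: cvgC_real. Qed.

Lemma psum_exp_real (x : R) : cvgC (psum (fexp x%:C) 1) (expR x)%:C.
Proof.
rewrite /expR; have := cvgC_series (is_cvg_series_exp_coeff x).
apply: cvgC_ext => N; rewrite /psum /series /= rmorph_sum.
apply: eq_bigr => k _; rewrite /= /exp_coeff /= expr1n mulr1.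
by rewrite rmorphM rmorphXn fmorphV rmorph_nat.
Qed.

Arguments psum_exp_real : clear implicits.

Lemma exprI k : 'i ^+ k = (if odd k then 'i else 1) * (-1) ^+ k./2 :> C.
Proof.
rewrite -{1}(odd_double_half k) exprD -mul2n exprM -complexiE sqr_i.
by case: odd; rewrite ?expr1 ?expr0.
Qed.

Lemma psum_exp_imag (y : R) : cvgC (psum (fexp ('i * y%:C)) 1) (cos y +i* sin y).
Proof.
rewrite cos.unlock sin.unlock.
have := cvgC_D (cvgC_series (@is_cvg_series_cos_coeff R y))
  (cvgC_M (cvgC_cst 'i) (cvgC_series (@is_cvg_series_sin_coeff R y))).
rewrite [_ +i* _]complexE /= complexiE.
apply: cvgC_ext => N; rewrite /psum /series /= !rmorph_sum mulr_sumr -big_split /=.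
apply: eq_bigr => k _; rewrite expr1n mulr1 exprMn exprI.
rewrite /cos_coeff /sin_coeff /= !rmorphM !rmorphXn !fmorphV !rmorph_nat rmorphN1.
case: (boolP (odd k)) => ok /=.
  have -> : k.-1./2 = k./2 by lia.
  by ring.
by ring.
Qed.

Arguments psum_exp_imag : clear implicits.

Lemma fexp_term (c : C) k : `|c| <= (1 / 8)%:C -> `|fexp c k * 1 ^+ k| <= (1 / 8 ^+ k)%:C.
Proof.
move=> c8; rewrite expr1n mulr1 /= normrM normrX normfV normr_nat.
have -> : (1 / 8 ^+ k)%:C = ((1 / 8)%:C ^+ k * 1) :> C.
  by rewrite mulr1 -[RHS]rmorphXn /= expr_div_n expr1n.
apply: ler_pM; rewrite ?exprn_ge0 ?invr_ge0 //.
  by rewrite lerXn2r // nnegrE // (le_trans _ c8).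
by rewrite invf_le1 ?ltr0n ?ler1n ?fact_gt0.
Qed.

(** The real series of [exp], [cos] and [sin] give the expansions at [x] and at [i y],
    which are multiplied as the values at [1] of the series of [e^(x X)] and [e^(i y X)].
    Small [z] suffice for an expansion near [0]. *)
Lemma cvgC_cexp (z : C) : `|z| <= (1 / 8)%:C -> cvgC (psum (fexp 1) z) (cexp z).
Proof.
move=> z8; pose x := complex.Re z; pose y := complex.Im z.
have zE : z = x%:C + 'i * y%:C by rewrite [LHS]complexE complexiE.
have x8 : `|x%:C| <= (1 / 8)%:C by rewrite normc_real; exact: le_trans (normc_ge_Re z) z8.
have y8 : `|'i * y%:C| <= (1 / 8)%:C.
  by rewrite normrM normCi [leLHS]mul1r normc_real; exact: le_trans (Im_le_norm z) z8.
have := cauchy_product ler01 ler01 (fun k => fexp_term k x8) (fun k => fexp_term k y8).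
rewrite -fexpD -zE => h.
have := cvgC_B (cvgC_M (psum_exp_real x) (psum_exp_imag y)) h; rewrite subr0.
apply: cvgC_ext => N; rewrite opprB addrC subrK.
by apply: eq_bigr => k _ /=; rewrite !expr1n mulr1 div1r mulrC.
Qed.

Lemma fact_inv_bound k : `|k`!%:R^-1| <= 1 :> C.
Proof. by rewrite normfV normr_nat invf_le1 ?ltr0n ?ler1n ?fact_gt0. Qed.

Lemma A_fps (t : C) nu : t != 1 -> A nu t = nu`!%:R * fps_inv (fconst t * fexp 1 - 1) nu.
Proof.
move=> t1; congr (_ * _); suff -> : coefs_at0 (fun z => (t * cexp z - 1)^-1) =
  fps_inv (fconst t * fexp 1 - 1) by [].
apply: coefs_at0E; apply: power_series_inv.
- by rewrite fcoefB fcoefCM /= expr0 fact0 divr1 mulr1 subr_eq0.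
- have [x x0 xE] := norm_real t; exists (x + 1) => k.
  rewrite fcoefB fcoefCM; apply: le_trans (ler_normB _ _) _.
  rewrite rmorphD rmorph1 normrM xE; apply: lerD.
    rewrite ler_piMr ?ler0c //= expr1n mul1r; exact: fact_inv_bound.
  by rewrite fcoef1 normr_nat; case: eqP.
have r0 : 0 < 1 / 8 :> R by rewrite divr_gt0.
apply: near0_intro r0 _ => z _ zr.
have := cvgC_B (cvgC_M (cvgC_cst t) (cvgC_cexp zr)) (cvgC_psum1 z).
apply: cvgC_ext => N.
by rewrite -psumC -psumB.
Qed.

Lemma bernoulli_fps k : bernoulli_num R k = k`!%:R * fbern C k.
Proof.
congr (_ * _); suff -> : coefs_at0 (fun x : C => x / (cexp x - 1)) = fbern C by [].
rewrite (_ : (fun x : C => _) = (fun x => ((cexp x - 1) / x)^-1)); last first.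
  by apply/funext => x; rewrite invf_div.
apply: coefs_at0E; apply: power_series_inv.
- by rewrite /= invr1 oner_neq0.
- by exists 1 => j /=; exact: fact_inv_bound.
have r0 : 0 < 1 / 8 :> R by rewrite divr_gt0.
apply: near0_intro r0 _ => z z0 zr.
have := cvgC_B (cvgC_cexp zr) (cvgC_psum1 z) => /cvgC_shift /cvgC_M/(_ (cvgC_cst z^-1)).
apply: cvgC_ext => N.
rewrite -psumB -fexp1m_divXE /psum big_nat_recl // fcoefXM0 mul0r add0r.
rewrite mulr_suml; apply: eq_bigr => k' _; rewrite fcoefXM exprSr.
by rewrite -!mulrA divff // mulr1.
Qed.

(** Under [X = 2 i w] the series of [X coth (X/2)] becomes twice that of [w cot w]. *)
Lemma Ccoef_fps j : Ccoef R j = (2 * 'i) ^+ (2 * j) / 2 * fcoth C (2 * j)%N.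
Proof.
have -> : fcoth C (2 * j)%N = 2 * fbern C (2 * j)%N.
  have e : 2 * fbern C = fconst 2 * fbern C by rewrite rmorph_nat.
  rewrite /fcoth fcoefD e.
  rewrite fcoefCM (_ : fX (2 * j)%N = 0) ?addr0 //=.
  by case: eqP => //; lia.
rewrite /Ccoef bernoulli_fps -mul2n exprMn.
have -> : 'i ^+ (2 * j) = (-1) ^+ j :> C by rewrite exprM -complexiE sqr_i.
by field; rewrite factr_neq0.
Qed.

End ExpSeries.

(** * Cotangents and roots of unity *)

Section Trig.
Variable R : realType.
Local Notation C := (R[i]).

Definition cis (x : R) : C := cos x +i* sin x.

Lemma cisE x : cis x = (cos x)%:C + 'i * (sin x)%:C.
Proof. by rewrite [LHS]complexE complexiE. Qed.

Lemma cis0 : cis 0 = 1.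
Proof. by rewrite /cis cos0 sin0. Qed.

Lemma cisD x y : cis (x + y) = cis x * cis y.
Proof.
by rewrite /cis cosD sinD [sin x * _ + _]addrC; simpc.
Qed.

Lemma cisN_mul x : cis x * cis (- x) = 1.
Proof. by rewrite -cisD subrr cis0. Qed.

Lemma cis_neq0 x : cis x != 0.
Proof. by apply/eqP => x0; have /eqP := cisN_mul x; rewrite x0 mul0r eq_sym oner_eq0. Qed.

Lemma cisN x : cis (- x) = (cis x)^-1.
Proof. by apply: (mulfI (cis_neq0 x)); rewrite cisN_mul divff ?cis_neq0. Qed.

Lemma cisMn x k : cis (x *+ k) = cis x ^+ k.
Proof. by elim: k => [|k IH]; rewrite ?mulr0n ?cis0 // mulrS cisD IH exprS. Qed.

Lemma cexp_imag (x : R) : cexp ('i * x%:C) = cis x.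
Proof. by rewrite -complexiE /cexp /=; simpc; rewrite /= expR0; simpc. Qed.

Lemma cos_cis x : (cos x)%:C = (cis x + cis (- x)) / 2.
Proof. by rewrite !cisE cosN sinN rmorphN; field. Qed.

Lemma cot_cis x : cis (x *+ 2) != 1 ->
  (cot x)%:C = 'i * ((cis (x *+ 2) + 1) / (cis (x *+ 2) - 1)).
Proof.
rewrite cisMn => x1.
have cs : (cos x)%:C ^+ 2 + (sin x)%:C ^+ 2 = 1 :> C.
  by rewrite -!rmorphXn -rmorphD /= cos2Dsin2.
have i2 : 'i ^+ 2 = -1 :> C by rewrite sqrCi.
have eD : cis x ^+ 2 + 1 = 2 * (cos x)%:C * cis x.
  by rewrite cisE -[X in _ + X]cs sqrrD exprMn i2; ring.
have eB : cis x ^+ 2 - 1 = 2 * 'i * (sin x)%:C * cis x.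
  rewrite cisE -[X in _ - X]cs sqrrD exprMn i2.
  have -> : 2 * 'i * (sin x)%:C * ((cos x)%:C + 'i * (sin x)%:C) =
    2 * 'i * (sin x)%:C * (cos x)%:C + 'i ^+ 2 * 2 * (sin x)%:C ^+ 2 by ring.
  by rewrite i2; ring.
have s0 : (sin x)%:C != 0 :> C.
  by apply/eqP => s0; move: x1; rewrite -subr_eq0 eB s0 mulr0 mul0r eqxx.
have x0 := cis_neq0 x.
have I0 : 'i != 0 :> C by exact: neq0Ci.
rewrite eD eB /cot fmorph_div /=; field.
by rewrite s0 x0 I0.
Qed.

Lemma cis_int (k : int) : cis (2 * pi * k%:~R) = 1.
Proof.
have cis2pi : cis (2 * pi) = 1.
  by rewrite mulr_natl /cis cos2pi sin_mulr2n sinpi mulr0 mul0rn.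
have nat_case n : cis (2 * pi * n%:R) = 1 by rewrite mulr_natr cisMn cis2pi expr1n.
case: k => n; first exact: nat_case.
by rewrite NegzE mulrNz mulrN cisN nat_case invr1.
Qed.

Lemma cis_eq1 (x : R) : cis (2 * pi * x) = 1 -> exists k : int, x = k%:~R.
Proof.
move=> x1; exists (Num.floor x).
pose r := x - (Num.floor x)%:~R.
have r1 : cis (2 * pi * r) = 1.
  by rewrite mulrBr cisD x1 cisN cis_int mul1r invr1.
have r0 : 0 <= r by rewrite subr_ge0 floor_le.
have rlt : r < 1 by rewrite ltrBlDl; have := floorD1_gt x; rewrite intrD.
apply/eqP; rewrite -subr_eq0 -/r; apply: contraTT isT => rn0.
have rp : 0 < r by rewrite lt_neqAle eq_sym rn0.
have spos : 0 < sin (pi * r).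
  apply: sin_gt0_pi; rewrite mulr_gt0 ?pi_gt0 //=.
  by rewrite gtr_pMr ?pi_gt0.
have /(congr1 (@complex.Re R)) /= := r1.
rewrite -mulrA mulr_natl cos_mulr2n => c1.
have := cos2Dsin2 (pi * r).
have := exprn_gt0 2 spos; lra.
Qed.

Lemma cis_root_neq1 (d p : nat) : (0 < p < d)%N -> cis (2 * pi / d%:R : R) ^+ p != 1.
Proof.
move=> /andP[p0 pd]; have d0 : (0 < d)%N by exact: leq_trans pd.
apply/eqP; rewrite -cisMn -(mulr_natr (2 * pi / d%:R) p) -mulrA => /cis_eq1[k pk].
have k0 : (0 : R) < k%:~R by rewrite -pk mulr_gt0 ?invr_gt0 ?ltr0n.
have k1 : (k%:~R : R) < 1 by rewrite -pk mulrC ltr_pdivrMr ?ltr0n // mul1r ltr_nat.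
by move: k0 k1; rewrite ltr0z ltrz1; lia.
Qed.

Lemma cis_root_eq1 (d : nat) : (0 < d)%N -> cis (2 * pi / d%:R : R) ^+ d = 1.
Proof.
move=> d0; have dR0 : d%:R != 0 :> R by rewrite pnatr_eq0 -lt0n.
rewrite -cisMn -(mulr_natr (2 * pi / d%:R) d) divfK // -(mulr1 (2 * pi)).
exact: (cis_int 1).
Qed.

(** Both exponentials in the cosine lead to sums of the same shape: inverting all
    points [z w^j] changes the sign of their images under [(x + 1) / (x - 1)]. *)
Lemma sum_cos_cot (m n d : nat) (b : R) (z := cis (2 * pi * b))
    (w := cis (2 * pi / d%:R : R)) : (0 < d)%N -> z ^+ d != 1 ->
  (\sum_(0 <= j < d) cos (2 * pi * m%:R * j%:R / d%:R)
     * cot (pi * j%:R / d%:R + pi * b) ^+ n)%:C =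
  'i ^+ n / 2 *
   (\sum_(j < d) w ^+ (m * j) * ((z * w ^+ j + 1) / (z * w ^+ j - 1)) ^+ n
    + (-1) ^+ n * \sum_(j < d) w^-1 ^+ (m * j)
        * ((z^-1 * w^-1 ^+ j + 1) / (z^-1 * w^-1 ^+ j - 1)) ^+ n).
Proof.
move=> d0 zd; have dR0 : d%:R != 0 :> R by rewrite pnatr_eq0 -lt0n.
have wd : w ^+ d = 1 by exact: cis_root_eq1.
have z0 : z != 0 by exact: cis_neq0.
have w0 : w != 0 by exact: cis_neq0.
pose h (x : C) := (x + 1) / (x - 1).
have hV x : x != 0 -> x != 1 -> h x^-1 = - h x.
  move=> x0 x1; rewrite /h; field.
  by rewrite subr_eq0 x1 x0 mulN1r subr_eq0 eq_sym x1.
have xj1 j : z * w ^+ j != 1.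
  apply/eqP => e; move/eqP: zd; apply.
  by have := congr1 (fun x => x ^+ d) e; rewrite exprMn exprAC wd !expr1n mulr1.
rewrite big_mkord rmorph_sum mulr_sumr -big_split mulr_sumr; apply: eq_bigr => j _.
rewrite -!/(h _).
have -> : 2 * pi * m%:R * j%:R / d%:R = (2 * pi / d%:R) *+ (m * j) :> R.
  by rewrite -(mulr_natr (2 * pi / d%:R)) natrM; field.
have cE : cis ((pi * j%:R / d%:R + pi * b) *+ 2) = z * w ^+ j.
  rewrite -cisMn -cisD; congr cis.
  by rewrite -(mulr_natr (pi * j%:R / d%:R + pi * b)) -(mulr_natr (2 * pi / d%:R)); field.
rewrite rmorphM rmorphXn /= cos_cis cisN cisMn -/w cot_cis cE ?xj1 // -/(h _).
rewrite !exprVn -invfM hV ?mulf_neq0 ?expf_neq0 //.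
rewrite [(- h _) ^+ n]exprNn exprMn.
have s2 : (-1) ^+ n * (-1) ^+ n = 1 :> C by rewrite -expr2 sqrr_sign.
transitivity ('i ^+ n / 2 * (w ^+ (m * j) * h (z * w ^+ j) ^+ n
   + ((-1) ^+ n * (-1) ^+ n) * ((w ^+ (m * j))^-1 * h (z * w ^+ j) ^+ n))).
  by rewrite s2; ring.
by ring.
Qed.

(** The expansion of the residue at [0] of [coth (X/2)^n e^(m X) / (t e^(d X) - 1)];
    here [F] is [1 / (t e^X - 1)] with [d X] substituted for [X]. *)
Lemma coef_sum_A (m n d : nat) (t : C) : (0 < n)%N -> t != 1 ->
  exists2 F : fps C, F * (fconst t * fexp 1 ^+ d - 1) = 1 &
  (fX * fcoth C ^+ n * fexp 1 ^+ m * F) n =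
  \sum_(j : {ffun 'I_n -> 'I_n}) \sum_(mu < n) \sum_(nu < n
        | ((\sum_(r < n) 2 * j r) + mu + nu == n - 1)%N)
      (m%:R ^+ mu / mu`!%:R) * (d%:R ^+ nu / nu`!%:R * A nu t)
      * \prod_(r < n) fcoth C (2 * j r)%N.
Proof.
move=> n0 t1; exists (fscale d%:R (fps_inv (fconst t * fexp 1 - 1))).
  have -> : fconst t * fexp 1 ^+ d - 1 = fscale (d%:R : C) (fconst t * fexp 1 - 1).
    by rewrite rmorphB rmorphM rmorph1 /= fscaleC fscale_fexp mulr1 -fexpMn.
  rewrite mulrC.
  rewrite -[LHS](rmorphM (fscale (d%:R : C))) /= mul_fps_inv ?rmorph1 //.
  by rewrite fcoefB fcoefCM /= expr0 fact0 divr1 mulr1 subr_eq0.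
rewrite fcoef_prod_expand //; last exact: fcoth_odd.
apply: eq_bigr => j _; apply: eq_bigr => mu _; apply: eq_bigr => nu _.
congr (_ * _ * _); first by rewrite -fexpMn.
by rewrite A_fps // mulrA divfK ?factr_neq0.
Qed.

Lemma Dcoef_fps (n : nat) (j : 'I_n -> nat) :
  Dcoef R j = (2 * 'i) ^+ (\sum_(r < n) 2 * j r) / 2 ^+ n
    * \prod_(r < n) fcoth C (2 * j r)%N.
Proof.
rewrite /Dcoef (eq_bigr _ (fun r _ => Ccoef_fps R (j r))) big_split /=; congr (_ * _).
rewrite big_split /= prodr_const card_ord exprVn; congr (_ / _).
by rewrite (big_morph _ (exprD _) (expr0 _)).
Qed.

(** The constants of a summand of total degree [s + a = N - 1] in [2 i] do not
    depend on how the degree is split. *)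
Lemma summand_constant a s N : N = (s + a).+1 ->
  'i ^+ (a + 1) * 2 ^+ a * ((2 * 'i) ^+ s / 2 ^+ N) = 'i ^+ N / 2 :> C.
Proof.
move=> ->; rewrite exprMn addn1 !exprS !exprD; field.
by rewrite !expf_neq0 // pnatr_eq0.
Qed.
End Trig.

(* The constraint 2 (j_1 + ... + j_n) + mu + nu = n - 1 forces every index to be
   at most n - 1, so letting the indices range over 'I_n loses no term. *)
Theorem theorem1p1 (R : realType) (m n d : nat) (b : R)
  (m_gt0 : (0 < m)%N) (n_gt0 : (0 < n)%N) (d_gt0 : (0 < d)%N)
  (m_lt_d : (m < d)%N)
  (b_notin : forall k : int, b <> k%:~R / d%:R) :
  let t1 : R[i] := cexp (- (2 * pi%:C * 'i * m%:R * b%:C)) in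
  let t2 : R[i] := cexp (- (2 * pi%:C * 'i * d%:R * b%:C)) in
  let t1' : R[i] := cexp (2 * pi%:C * 'i * m%:R * b%:C) in
  let t2' : R[i] := cexp (2 * pi%:C * 'i * d%:R * b%:C) in
  (\sum_(0 <= j < d)
     cos (2 * pi * m%:R * j%:R / d%:R)
     * cot (pi * j%:R / d%:R + pi * b) ^+ n)%:C
  = - \sum_(j : {ffun 'I_n -> 'I_n}) \sum_(mu < n) \sum_(nu < n
        | ((\sum_(r < n) 2 * j r) + mu + nu == n - 1)%N)
      'i ^+ (mu + nu + 1) * 2 ^+ (mu + nu)
      * (m%:R ^+ mu / mu`!%:R) * (d%:R ^+ nu.+1 / nu`!%:R)
      * (t1 * A nu t2 - (-1) ^+ (mu + nu) * t1' * A nu t2')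
      * Dcoef R (fun r => j r).
Proof.
move=> t1 t2 t1' t2'.
have dR0 : d%:R != 0 :> R by rewrite pnatr_eq0 -lt0n.
pose z := cis (2 * pi * b); pose w := cis (2 * pi / d%:R : R).
have z0 : z != 0 by exact: cis_neq0.
have expE k : cexp (2 * pi%:C * 'i * k%:R * b%:C) = z ^+ k.
  rewrite -cisMn -cexp_imag; congr cexp.
  by rewrite -(mulr_natr (2 * pi * b) k) !rmorphM !rmorph_nat; ring.
have expNE k : cexp (- (2 * pi%:C * 'i * k%:R * b%:C)) = z ^- k.
  rewrite -cisMn -cisN -cexp_imag; congr cexp.
  by rewrite rmorphN -(mulr_natr (2 * pi * b) k) !rmorphM !rmorph_nat; ring.
have t1E : t1 = z ^- m by exact: expNE.
have t2E : t2 = z ^- d by exact: expNE.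
have t1E' : t1' = z ^+ m by exact: expE.
have t2E' : t2' = z ^+ d by exact: expE.
have zd : z ^+ d != 1.
  apply/eqP; rewrite -cisMn -(mulr_natr (2 * pi * b) d) -mulrA => /cis_eq1[k bk].
  by apply: (b_notin k); rewrite -bk mulfK.
have wd : w ^+ d = 1 by exact: cis_root_eq1.
have w_prim p : (0 < p < d)%N -> w ^+ p != 1 by exact: cis_root_neq1.
have z'd : (z^-1) ^+ d != 1 by rewrite exprVn invr_eq1.
have w'd : (w^-1) ^+ d = 1 by rewrite exprVn wd invr1.
have w'_prim p : (0 < p < d)%N -> (w^-1) ^+ p != 1.
  by move=> pd; rewrite exprVn invr_eq1 w_prim.
have t21 : t2 != 1 by rewrite t2E invr_eq1.
have t21' : t2' != 1 by rewrite t2E'.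
have [F FE FA] := coef_sum_A m d n_gt0 t21.
have [F' FE' FA'] := coef_sum_A m d n_gt0 t21'.
rewrite t2E in FE; rewrite t2E' in FE'.
have {}FE' : F' * (fconst (z^-1 ^- d) * fexp 1 ^+ d - 1) = 1.
  by rewrite exprVn invrK.
rewrite sum_cos_cot // -/z -/w.
rewrite (sum_root_coth wd w_prim m_gt0 m_lt_d z0 zd FE n).
rewrite (sum_root_coth w'd w'_prim m_gt0 m_lt_d (invr_neq0 z0) z'd FE' n).
rewrite exprVn invrK -t1E -t1E'.
(* The two residues stay opaque until the constants are collected. *)
move: FA FA'; move: (fcoef _ n) (fcoef _ n) => X' X XE XE'.
transitivity (- ('i ^+ n / 2 * d%:R * (t1 * X + (-1) ^+ n * t1' * X'))); first by ring.
congr (- _); rewrite {}XE {}XE'.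
rewrite !mulr_sumr -big_split mulr_sumr; apply: eq_bigr => j _.
rewrite !mulr_sumr -big_split mulr_sumr; apply: eq_bigr => mu _.
rewrite !mulr_sumr -big_split mulr_sumr; apply: eq_bigr => nu /eqP munu.
rewrite Dcoef_fps.
set P := \prod_(r < n) _; set S := (\sum_(r < n) 2 * j r)%N in munu *.
have Sev : ~~ odd S.
  by rewrite /S -big_distrr /= mul2n odd_double.
have nE : n = (S + (mu + nu)).+1 by lia.
(* This is where the sign of the second half of each summand comes from. *)
have sgn : (-1) ^+ n = - (-1) ^+ (mu + nu) :> R[i].
  by rewrite [in LHS]nE exprS exprD -[_ ^+ S]signr_odd (negbTE Sev) expr0; ring.
rewrite sgn -(summand_constant R nE) [_ ^+ nu.+1]exprS -[d%:R * _ / _]mulrA /=.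
move: (m%:R ^+ mu / _) (d%:R ^+ nu / _) (A nu t2) (A nu t2') (_ / 2 ^+ n) P => c1 c2 a a' q P.
by ring.
Qed.
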